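(* (i) Each of the four insertion rules (1)–(4) leaves both $N$ and $p-q$ unchanged, and shifts $\mu$ and $\nu$ by $\pm\tau$ according to $$\Delta\mu=(+\tau,-\tau,-\tau,+\tau),\qquad \Delta\nu=(-\tau,-\tau,+\tau,+\tau)$$ for the rules in the order (1),(2),(3),(4). Consequently the Euler, Erdélyi–Kober, differentiation and Laplace insertions (i.e. every single-kernel operation listed in the context) preserve $N$ exactly. (ii) Mellin convolution, which multiplies two kernels $\phi_1\phi_2$ with a common $\tau$ (concatenating the parameter blocks) rather than inserting a multiplier into one, satisfies $N=N_1+N_2$, $\alpha=\alpha_1+\alpha_2$, and likewise $\mu=\mu_1+\mu_2$, $\nu=\nu_1+\nu_2$, $\xi=\xi_1+\xi_2$.
   Context: Let $\tau>0$ and let $G(z;\tau)$ be the Barnes double gamma function: the entire function $G(z;\tau)=\frac{z}{\tau}e^{c_1 z/\tau+c_2 z^2/(2\tau^2)}\prod_{(k,l)\in\mathbb{Z}_{\ge0}^2\setminus\{(0,0)\}}\big(1+\frac{z}{k\tau+l}\big)e^{-\frac{z}{k\tau+l}+\frac{z^2}{2(k\tau+l)^2}}$, with real constants $c_1,c_2$ uniquely determined by $G(z+1;\tau)=\Gamma(z/\tau)G(z;\tau)$ and $G(z+\tau;\tau)=(2\pi)^{(\tau-1)/2}\tau^{1/2-z}\Gamma(z)G(z;\tau)$. A kernel of order $(m,n,p,q)$ ($0\le m\le q$, $0\le n\le p$), with $\mathbf a\in\mathbb{C}^p$, $\mathbf b\in\mathbb{C}^q$, $\alpha\in\mathbb{C}$,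 is $$\phi(s)=\frac{\prod_{j=1}^{m}G(b_j-s;\tau)\prod_{j=1}^{n}G(1+\tau-a_j+s;\tau)}{\prod_{j=m+1}^{q}G(1+\tau-b_j+s;\tau)\prod_{j=n+1}^{p}G(a_j-s;\tau)}\,e^{\pi\alpha s^2/\tau}.$$ To it are attached $N=2(m+n)-p-q$, $\nu=\sum_{j\le p}a_j-\sum_{j\le q}b_j$, $\mu=\sum_{j\le n}a_j-\sum_{n<j\le p}a_j+\sum_{j\le m}b_j-\sum_{m<j\le q}b_j$, and $\xi$ defined as $\mu$ with each parameter squared. Numerator block: $a_1..a_n$, $b_1..b_m$; denominator block: the rest. Insertion rules (multiplying $\phi$ by $R(s)$ gives $C\lambda^{-s}$ times the kernel with the enlarged data, same $\tau,\alpha$): (1) $R=\Gamma(c-s)$: add $a$-parameter $c$ (denominator), $b$-parameter $c+\tau$ (numerator). (2) $R=\Gamma(c+s)$: add $a$-parameter $1-c$ (numerator), $b$-parameter $1+\tau-c$ (denominator). (3) $R=1/\Gamma(c-s)$: add $a$-parameter $c+\tau$ (denominator), $b$-parameter $c$ (numerator). (4) $R=1/\Gamma(c+s)$: add $a$-parameter $1+\tau-c$ (numerator), $b$-parameter $1-c$ (denominator). Adding a numerator $a$-parameter increments $n,p$; a denominator $a$-parameter increments $p$; a numerator $b$-parameter increments $m,q$; a denominator $b$-parameter increments $q$. Single-kernel operations: insertion of the multipliers $\frac{\Gamma(\gamma+1-s)}{\Gamma(\gamma+\delta+1-s)}$ (Erdélyi–Kober), $\Gamma(\gamma)\frac{\Gamma(\beta-s)}{\Gamma(\beta+\gamma-s)}$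 (Euler), $(-1)^k\frac{\Gamma(s+k)}{\Gamma(s)}$ ($k$-th derivative), and $\Gamma(s)$ applied to the reflected kernel $\phi(1-s)$ (Laplace). *)

(* Defs.v *)
From HB Require Import structures.
From mathcomp Require Import all_boot all_order all_algebra finmap complex.
From mathcomp Require Import all_classical all_reals all_analysis.
From mathcomp Require Import showcase.summability.
Set Implicit Arguments.
Unset Strict Implicit.
Unset Printing Implicit Defensive.
Import Order.TTheory GRing.Theory Num.Theory.
Import numFieldNormedType.Exports.
Local Open Scope classical_set_scope.
Local Open Scope ring_scope.

(* R[i] presented as a numClosedFieldType, so that it inherits the topology
   that MathComp-Analysis puts on every numFieldType. *)
Definition Cplx (R : realType) : numClosedFieldType := R[i].

Definition inC (R : realType) (x : R) : Cplx R := (x%:C)%C.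

Definition cexp (R : realType) (z : Cplx R) : Cplx R :=
  inC (expR (complex.Re z)) * (cos (complex.Im z) +i* sin (complex.Im z))%C.

(* t ^ z for a real base t > 0, with the principal (real) logarithm of t. *)
Definition rpow (R : realType) (t : R) (z : Cplx R) : Cplx R :=
  cexp (z * inC (ln t)).

(* Euler's limit n! n^z / (z (z+1) ... (z+n)).  Since x / 0 = 0, its value at
   the poles z = 0, -1, -2, ... is 0, so that (cgamma z)^-1 is the entire
   function 1/Gamma everywhere. *)
Definition cgamma (R : realType) (z : Cplx R) : Cplx R :=
  lim ((n`!%:R * rpow (n%:R : R) z / \prod_(0 <= k < n.+1) (z + k%:R))
         @[n --> \oo]).

Definition gamma_pole (R : realType) (z : Cplx R) : Prop :=
  exists k : nat, z = - k%:R.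

Definition barnes_factor (R : realType) (tau : R) (z : Cplx R)
    (kl : nat * nat) : Cplx R :=
  let w := kl.1%:R * inC tau + kl.2%:R in
  (1 + z / w) * cexp (- (z / w) + z ^+ 2 / (2 * w ^+ 2)).

(* Finite partial products; the infinite product is their limit along the
   net of all finite index sets, i.e. unconditional convergence. *)
Definition barnes_partial_prod (R : realType) (tau : R) (z : Cplx R)
    (A : {fset nat * nat}) : Cplx R :=
  \prod_(kl <- A | kl != (0%N, 0%N)) barnes_factor tau z kl.

Definition is_barnes_double_gamma (R : realType) (tau : R)
    (G : Cplx R -> Cplx R) : Prop :=
  let t := inC tau in
  exists c1 c2 : R,
  [/\ forall z,
        cvg (barnes_partial_prod tau z @ totally) /\
        G z = z / t
              * cexp (inC c1 * z / t + inC c2 * z ^+ 2 / (2 * t ^+ 2))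
              * lim (barnes_partial_prod tau z @ totally),
      forall z, ~ gamma_pole (z / t) ->
        G (z + 1) = cgamma (z / t) * G z
    & forall z, ~ gamma_pole z ->
        G (z + t) = rpow (2 * pi) ((t - 1) / 2) * rpow tau (2^-1 - z)
                    * cgamma z * G z].

(* The parameter vectors are stored by blocks:
   a_num = (a_1..a_n), a_den = (a_(n+1)..a_p),
   b_num = (b_1..b_m), b_den = (b_(m+1)..b_q);
   thus 0 <= n <= p and 0 <= m <= q hold by construction. *)
Record kernel_data (R : realType) := KernelData {
  a_num : seq (Cplx R);
  a_den : seq (Cplx R);
  b_num : seq (Cplx R);
  b_den : seq (Cplx R);
  alpha : Cplx R
}.

Definition ord_m (R : realType) (D : kernel_data R) : nat := size (b_num D).
Definition ord_n (R : realType) (D : kernel_data R) : nat := size (a_num D).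
Definition ord_p (R : realType) (D : kernel_data R) : nat :=
  (size (a_num D) + size (a_den D))%N.
Definition ord_q (R : realType) (D : kernel_data R) : nat :=
  (size (b_num D) + size (b_den D))%N.

Definition invN (R : realType) (D : kernel_data R) : int :=
  2 * ((ord_m D)%:Z + (ord_n D)%:Z) - (ord_p D)%:Z - (ord_q D)%:Z.

Definition inv_nu (R : realType) (D : kernel_data R) : Cplx R :=
  \sum_(a <- a_num D ++ a_den D) a - \sum_(b <- b_num D ++ b_den D) b.

Definition inv_mu (R : realType) (D : kernel_data R) : Cplx R :=
  \sum_(a <- a_num D) a - \sum_(a <- a_den D) a
  + \sum_(b <- b_num D) b - \sum_(b <- b_den D) b.

Definition inv_xi (R : realType) (D : kernel_data R) : Cplx R :=
  \sum_(a <- a_num D) a ^+ 2 - \sum_(a <- a_den D) a ^+ 2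
  + \sum_(b <- b_num D) b ^+ 2 - \sum_(b <- b_den D) b ^+ 2.

Definition kernel_denominator (R : realType) (tau : R) (G : Cplx R -> Cplx R)
    (D : kernel_data R) (s : Cplx R) : Cplx R :=
  (\prod_(b <- b_den D) G (1 + inC tau - b + s))
  * \prod_(a <- a_den D) G (a - s).

Definition barnes_kernel (R : realType) (tau : R) (G : Cplx R -> Cplx R)
    (D : kernel_data R) (s : Cplx R) : Cplx R :=
  (\prod_(b <- b_num D) G (b - s)) *
  (\prod_(a <- a_num D) G (1 + inC tau - a + s))
  / kernel_denominator tau G D s
  * cexp (inC pi * alpha D * s ^+ 2 / inC tau).

(* f = C lambda^(-s) phi_D wherever the denominator of phi_D does not vanish;
   lambda = e^ell, so that lambda^(-s) = e^(- s ell) also for complex lambda. *)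
Definition has_kernel (R : realType) (tau : R) (G : Cplx R -> Cplx R)
    (f : Cplx R -> Cplx R) (D : kernel_data R) : Prop :=
  exists C ell : Cplx R, forall s, kernel_denominator tau G D s != 0 ->
    f s = C * cexp (- s * ell) * barnes_kernel tau G D s.

Definition add_a_num (R : realType) (c : Cplx R) (D : kernel_data R) :=
  KernelData (c :: a_num D) (a_den D) (b_num D) (b_den D) (alpha D).
Definition add_a_den (R : realType) (c : Cplx R) (D : kernel_data R) :=
  KernelData (a_num D) (c :: a_den D) (b_num D) (b_den D) (alpha D).
Definition add_b_num (R : realType) (c : Cplx R) (D : kernel_data R) :=
  KernelData (a_num D) (a_den D) (c :: b_num D) (b_den D) (alpha D).
Definition add_b_den (R : realType) (c : Cplx R) (D : kernel_data R) :=
  KernelData (a_num D) (a_den D) (b_num D) (c :: b_den D) (alpha D).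

Variant insertion_rule :=
  | GammaMinus      (* Gamma(c - s) *)
  | GammaPlus       (* Gamma(c + s) *)
  | InvGammaMinus   (* 1 / Gamma(c - s) *)
  | InvGammaPlus.   (* 1 / Gamma(c + s) *)

Definition multiplier (R : realType) (r : insertion_rule) (c s : Cplx R) :
    Cplx R :=
  match r with
  | GammaMinus => cgamma (c - s)
  | GammaPlus => cgamma (c + s)
  | InvGammaMinus => (cgamma (c - s))^-1
  | InvGammaPlus => (cgamma (c + s))^-1
  end.

Definition insertion (R : realType) (tau : R) (r : insertion_rule)
    (c : Cplx R) (D : kernel_data R) : kernel_data R :=
  let t := inC tau in
  match r with
  | GammaMinus => add_a_den c (add_b_num (c + t) D)
  | GammaPlus => add_a_num (1 - c) (add_b_den (1 + t - c) D)
  | InvGammaMinus => add_a_den (c + t) (add_b_num c D)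
  | InvGammaPlus => add_a_num (1 + t - c) (add_b_den (1 - c) D)
  end.

(* Data of phi_D(1 - s), up to a factor C lambda^(-s) that comes from
   (1 - s)^2 = 1 - 2s + s^2 in the exponential: for instance
   G(b - (1 - s)) = G(1 + tau - (2 + tau - b) + s). *)
Definition reflect_data (R : realType) (tau : R) (D : kernel_data R) :
    kernel_data R :=
  let refl c := 2 + inC tau - c in
  KernelData (map refl (b_num D)) (map refl (b_den D))
             (map refl (a_num D)) (map refl (a_den D)) (alpha D).

Variant single_kernel_op (R : realType) :=
  | ErdelyiKober of Cplx R & Cplx R   (* gamma, delta *)
  | Euler of Cplx R & Cplx R          (* beta, gamma *)
  | Derivative of nat
  | Laplace.
Arguments Derivative {R}.
Arguments Laplace {R}.

Definition op_kernel (R : realType) (op : single_kernel_op R)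
    (phi : Cplx R -> Cplx R) (s : Cplx R) : Cplx R :=
  match op with
  | ErdelyiKober g d => cgamma (g + 1 - s) / cgamma (g + d + 1 - s) * phi s
  | Euler b g => cgamma g * (cgamma (b - s) / cgamma (b + g - s)) * phi s
  | Derivative k => (-1) ^+ k * (cgamma (s + k%:R) / cgamma s) * phi s
  | Laplace => cgamma s * phi (1 - s)
  end.

Definition op_data (R : realType) (tau : R) (op : single_kernel_op R)
    (D : kernel_data R) : kernel_data R :=
  let ins := insertion tau in
  match op with
  | ErdelyiKober g d =>
      ins InvGammaMinus (g + d + 1) (ins GammaMinus (g + 1) D)
  | Euler b g => ins InvGammaMinus (b + g) (ins GammaMinus b D)
  | Derivative k => ins InvGammaPlus 0 (ins GammaPlus k%:R D)
  | Laplace => ins GammaPlus 0 (reflect_data tau D)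
  end.

Definition mellin_convolution (R : realType) (D1 D2 : kernel_data R) :
    kernel_data R :=
  KernelData (a_num D1 ++ a_num D2) (a_den D1 ++ a_den D2)
             (b_num D1 ++ b_num D2) (b_den D1 ++ b_den D2)
             (alpha D1 + alpha D2).

Definition delta_mu (R : realType) (tau : R) (r : insertion_rule) : Cplx R :=
  match r with
  | GammaMinus => inC tau
  | GammaPlus => - inC tau
  | InvGammaMinus => - inC tau
  | InvGammaPlus => inC tau
  end.

Definition delta_nu (R : realType) (tau : R) (r : insertion_rule) : Cplx R :=
  match r with
  | GammaMinus => - inC tau
  | GammaPlus => - inC tau
  | InvGammaMinus => inC tau
  | InvGammaPlus => inC tau
  end.

(* Main.v *)
Require Import Defs.
From mathcomp Require Import all_boot all_order all_algebra complex.
From mathcomp Require Import all_classical all_reals all_analysis.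
From mathcomp Require Import finmap ring.
From mathcomp Require Import showcase.summability.
Set Implicit Arguments.
Unset Strict Implicit.
Unset Printing Implicit Defensive.
Import Order.TTheory GRing.Theory Num.Theory.
Import numFieldNormedType.Exports.
Local Open Scope ring_scope.

(** The only analytic input is the quasi-periodicity of the double gamma
    function in the direction [tau].  With suitable constants [A] and [L],
    [Gamma(z) = e^(A + zL) G(z + tau) / G(z)], so multiplying a kernel by
    [Gamma(c - s)] or [Gamma(c + s)], or by the inverse of one of them, is the
    same, up to a factor [C lambda^(-s)], as multiplying it by a quotient of
    two values of [G] whose arguments differ by [tau].  This quotient is
    absorbed by one new numerator and one new denominator parameter
    ([barnes_shift], [multiplier_ratio], [has_kernel_insertion]).

    The functional equation is only given away from the poles of [Gamma].
    At a pole [G(z) = 0], because the prefactor [z/tau] or a factor of the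
    infinite product vanishes, and the value assigned to [Gamma(z)] is [0],
    because Euler's quotients are eventually [0].  Hence the formula for [Gamma]
    holds wherever [G(z)] is nonzero, and the formula for [1/Gamma] wherever
    [G(z + tau)] is nonzero; the nonvanishing of the denominator of the enlarged
    kernel provides these conditions.

    The invariants are sums over the parameter blocks, so their variation under
    an insertion depends only on the two new parameters.  The single-kernel
    operations are, up to a constant factor, composites of two insertions,
    except the Laplace one, which is one insertion into the reflected kernel ([has_kernel_reflect]);
    therefore they preserve [N].  In a Mellin convolution the blocks are
    concatenated and everything is additive. *)

(** * Complex exponential *)

Lemma cexpD (R : realType) (x y : Cplx R) : cexp (x + y) = cexp x * cexp y.
Proof.
case: x => a b; case: y => c d.
rewrite /cexp /inC /=; apply/eqP; rewrite eq_complex /=.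
by rewrite expRD cosD sinD; apply/andP; split; apply/eqP; ring.
Qed.

Lemma cexp0 (R : realType) : cexp (0 : Cplx R) = 1.
Proof.
rewrite /cexp /inC /= expR0 cos0 sin0; apply/eqP.
by rewrite eq_complex /= !mulr1 !mulr0 subr0 addr0 !eqxx.
Qed.

(** * Gamma and double gamma at the poles of Gamma *)

Lemma cgamma_pole (R : realType) (z : Cplx R) : gamma_pole z -> cgamma z = 0.
Proof.
move=> [k zk]; apply: lim_near_cst; first exact: norm_hausdorff.
near=> n.
(* As soon as k <= n, the denominator contains the factor z + k = 0. *)
have kn : (k < n.+1)%N by rewrite ltnS; near: n; exact: nbhs_infty_ge.
have -> : \prod_(0 <= j < n.+1) (z + j%:R) = 0.
  by rewrite big_mkord (bigD1 (Ordinal kn)) //= zk addNr mul0r.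
by rewrite invr0 mulr0.
Unshelve. all: by end_near.
Qed.

Lemma barnes_pole (R : realType) (tau : R) (G : Cplx R -> Cplx R)
    (z : Cplx R) :
  is_barnes_double_gamma tau G -> gamma_pole z -> G z = 0.
Proof.
move=> [c1 [c2 [/(_ z) [_ ->] _ _]]] [[|l] ->]; first by rewrite oppr0 !mul0r.
rewrite [X in _ * X](_ : _ = 0) ?mulr0 //.
have totally_proper := @totally_filter (nat * nat)%type.
apply: (lim_near_cst (@norm_hausdorff _ _)).
near=> A.
have lA : (0%N, l.+1) \in A.
  by rewrite -fsub1set; near: A; exists [fset (0%N, l.+1)]%fset.
(* The factor of index (0, l + 1) is 1 + z / (l + 1) = 0. *)
apply/eqP; rewrite /barnes_partial_prod prodf_seq_eq0; apply/hasP.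
exists (0%N, l.+1) => //=; rewrite /barnes_factor /=.
by rewrite mul0r add0r mulNr divff ?pnatr_eq0 // subrr mul0r.
Unshelve. all: by end_near.
Qed.

(** * The shift of the double gamma function by tau *)

(** The functional equation in the direction [tau], solved for [Gamma] and for
    [1/Gamma].  Here [e^(-(A + zL))] is the elementary factor
    [(2 pi)^((tau - 1)/2) tau^(1/2 - z)].  The hypotheses allow poles of [Gamma]
    only in the second formula, where both sides are then [0]. *)
Lemma barnes_shift (R : realType) (tau : R) (G : Cplx R -> Cplx R) :
  is_barnes_double_gamma tau G ->
  exists A L : Cplx R, forall z,
    (G z != 0 -> cgamma z = cexp (A + z * L) * (G (z + inC tau) / G z)) /\
    (G (z + inC tau) != 0 ->
       (cgamma z)^-1 = cexp (- (A + z * L)) * (G z / G (z + inC tau))).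
Proof.
move=> barnesG; have [_ [_ [_ _ shift]]] := barnesG.
pose L : Cplx R := inC (ln tau).
pose A : Cplx R := - ((inC tau - 1) / 2 * inC (ln (2 * pi)) + 2^-1 * L).
exists A, L => z.
have [zpole|/shift Gz] := pselect (gamma_pole z).
  rewrite (cgamma_pole zpole) (barnes_pole barnesG zpole) eqxx.
  by rewrite invr0 !mul0r mulr0.
have {}Gz : G (z + inC tau) = cexp (- (A + z * L)) * cgamma z * G z.
  by rewrite Gz /rpow -cexpD; congr (cexp _ * _ * _); rewrite /A -/L; ring.
split=> [Gz0|].
  by rewrite Gz mulfK // mulrA -cexpD subrr cexp0 mul1r.
rewrite Gz; move: (cexp _) => E.
rewrite !mulf_eq0 !negb_or => /andP[/andP[E0 g0] G0].
by field; rewrite E0 g0 G0.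
Qed.

(** * Kernels up to exponential factors *)

Lemma has_kernel_refl (R : realType) (tau : R) (G : Cplx R -> Cplx R)
    (D : kernel_data R) : has_kernel tau G (barnes_kernel tau G D) D.
Proof. by exists 1, 0 => s _; rewrite mulr0 cexp0 !mul1r. Qed.

Lemma has_kernel_scale (R : realType) (tau : R) (G f g : Cplx R -> Cplx R)
    (k : Cplx R) (D : kernel_data R) :
  (forall s, g s = k * f s) -> has_kernel tau G f D -> has_kernel tau G g D.
Proof.
move=> gE [C [ell fE]]; exists (k * C), ell => s Ds.
by rewrite gE fE // !mulrA.
Qed.

(** * Insertion rules *)

(** The argument of [Gamma] in the multiplier of each insertion rule. *)
Definition insertion_point (R : realType) (r : insertion_rule)
    (c s : Cplx R) : Cplx R :=
  match r with
  | GammaMinus | InvGammaMinus => c - s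
  | GammaPlus | InvGammaPlus => c + s
  end.

(** The factor by which an insertion enlarges the denominator of the kernel. *)
Definition insertion_den (R : realType) (tau : R) (G : Cplx R -> Cplx R)
    (r : insertion_rule) (c s : Cplx R) : Cplx R :=
  let z := insertion_point r c s in
  match r with
  | GammaMinus | GammaPlus => G z
  | InvGammaMinus | InvGammaPlus => G (z + inC tau)
  end.

(** The quotient of two values of [G] by which an insertion multiplies the
    kernel. *)
Definition insertion_ratio (R : realType) (tau : R) (G : Cplx R -> Cplx R)
    (r : insertion_rule) (c s : Cplx R) : Cplx R :=
  let z := insertion_point r c s in
  match r with
  | GammaMinus | GammaPlus => G (z + inC tau) / G z
  | InvGammaMinus | InvGammaPlus => G z / G (z + inC tau)
  end.

Lemma kernel_denominator_insertion (R : realType) (tau : R)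
    (G : Cplx R -> Cplx R) (r : insertion_rule) (c : Cplx R)
    (D : kernel_data R) (s : Cplx R) :
  kernel_denominator tau G (insertion tau r c D) s =
  insertion_den tau G r c s * kernel_denominator tau G D s.
Proof.
case: r; rewrite /kernel_denominator /insertion_den /= big_cons.
- by rewrite mulrCA.
- by rewrite mulrA; congr (G _ * _ * _); ring.
- by rewrite mulrCA; congr (G _ * _); ring.
- by rewrite mulrA; congr (G _ * _ * _); ring.
Qed.

Lemma barnes_kernel_insertion (R : realType) (tau : R)
    (G : Cplx R -> Cplx R) (r : insertion_rule) (c : Cplx R)
    (D : kernel_data R) (s : Cplx R) :
  barnes_kernel tau G (insertion tau r c D) s =
  insertion_ratio tau G r c s * barnes_kernel tau G D s.
Proof.
rewrite /barnes_kernel kernel_denominator_insertion invfM.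
rewrite /insertion_den /insertion_ratio.
case: r => /=; rewrite big_cons.
- by rewrite (_ : c + inC tau - s = c - s + inC tau); ring.
- by rewrite (_ : 1 + inC tau - (1 - c) + s = c + s + inC tau); ring.
- by ring.
- by rewrite (_ : 1 + inC tau - (1 + inC tau - c) + s = c + s); ring.
Qed.

Lemma multiplier_ratio (R : realType) (tau : R) (G : Cplx R -> Cplx R)
    (r : insertion_rule) (c : Cplx R) :
  is_barnes_double_gamma tau G ->
  exists C ell : Cplx R, forall s, insertion_den tau G r c s != 0 ->
    multiplier r c s = C * cexp (- s * ell) * insertion_ratio tau G r c s.
Proof.
move=> /barnes_shift[A [L GE]].
case: r; rewrite /insertion_den /insertion_ratio /=.
- exists (cexp (A + c * L)), L => s Gs; rewrite (GE _).1 // -cexpD.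
  by congr (cexp _ * _); ring.
- exists (cexp (A + c * L)), (- L) => s Gs; rewrite (GE _).1 // -cexpD.
  by congr (cexp _ * _); ring.
- exists (cexp (- (A + c * L))), (- L) => s Gs; rewrite (GE _).2 // -cexpD.
  by congr (cexp _ * _); ring.
- exists (cexp (- (A + c * L))), L => s Gs; rewrite (GE _).2 // -cexpD.
  by congr (cexp _ * _); ring.
Qed.

(** Stated for any [f] represented by [D], so that insertions compose.  The
    equality for [f] may be used because the denominator of [D] divides that of
    the enlarged data. *)
Lemma has_kernel_insertion (R : realType) (tau : R) (G f : Cplx R -> Cplx R)
    (r : insertion_rule) (c : Cplx R) (D : kernel_data R) :
  is_barnes_double_gamma tau G -> has_kernel tau G f D ->
  has_kernel tau G (fun s => multiplier r c s * f s) (insertion tau r c D).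
Proof.
move=> /(multiplier_ratio r c)[C1 [l1 mE]] [C2 [l2 fE]].
exists (C1 * C2), (l1 + l2) => s.
rewrite kernel_denominator_insertion mulf_eq0 negb_or => /andP[/mE -> /fE ->].
by rewrite barnes_kernel_insertion mulrDr cexpD; ring.
Qed.

Lemma invN_insertion (R : realType) (tau : R) (r : insertion_rule)
    (c : Cplx R) (D : kernel_data R) : invN (insertion tau r c D) = invN D.
Proof.
by case: r; rewrite /invN /ord_m /ord_n /ord_p /ord_q /= ?addSn ?addnS !intS; ring.
Qed.

Lemma ord_pq_insertion (R : realType) (tau : R) (r : insertion_rule)
    (c : Cplx R) (D : kernel_data R) :
  (ord_p (insertion tau r c D))%:Z - (ord_q (insertion tau r c D))%:Z =
  (ord_p D)%:Z - (ord_q D)%:Z.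
Proof.
by case: r; rewrite /ord_p /ord_q /= ?addSn ?addnS !intS; ring.
Qed.

Lemma inv_mu_insertion (R : realType) (tau : R) (r : insertion_rule)
    (c : Cplx R) (D : kernel_data R) :
  inv_mu (insertion tau r c D) = inv_mu D + delta_mu tau r.
Proof. by case: r; rewrite /inv_mu /= !big_cons; ring. Qed.

Lemma inv_nu_insertion (R : realType) (tau : R) (r : insertion_rule)
    (c : Cplx R) (D : kernel_data R) :
  inv_nu (insertion tau r c D) = inv_nu D + delta_nu tau r.
Proof.
by case: r; rewrite /inv_nu /= !(big_cat, big_cons) /=; ring.
Qed.

(** * Reflection of a kernel *)

(** Reflection exchanges the roles of the [a] and [b] parameters.  The factor
    [C lambda^(-s)] comes from [(1 - s)^2 = 1 - 2s + s^2]. *)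
Lemma has_kernel_reflect (R : realType) (tau : R) (G : Cplx R -> Cplx R)
    (D : kernel_data R) :
  has_kernel tau G (fun s => barnes_kernel tau G D (1 - s))
             (reflect_data tau D).
Proof.
pose e := inC pi * alpha D / inC tau.
exists (cexp e), (2 * e) => s _.
have refl_plus (r : seq (Cplx R)) :
    \prod_(x <- map (fun c => 2 + inC tau - c) r) G (1 + inC tau - x + s) =
    \prod_(x <- r) G (x - (1 - s)).
  by rewrite big_map; apply: eq_bigr => x _; congr G; ring.
have refl_minus (r : seq (Cplx R)) :
    \prod_(x <- map (fun c => 2 + inC tau - c) r) G (x - s) =
    \prod_(x <- r) G (1 + inC tau - x + (1 - s)).
  by rewrite big_map; apply: eq_bigr => x _; congr G; ring.
rewrite /barnes_kernel /kernel_denominator /= !refl_plus !refl_minus.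
have -> : inC pi * alpha D * (1 - s) ^+ 2 / inC tau =
    e + (- s * (2 * e) + inC pi * alpha D * s ^+ 2 / inC tau).
  by rewrite /e; ring.
by rewrite !cexpD !invfM; ring.
Qed.

Lemma invN_reflect (R : realType) (tau : R) (D : kernel_data R) :
  invN (reflect_data tau D) = invN D.
Proof.
by rewrite /invN /ord_m /ord_n /ord_p /ord_q /= !size_map; ring.
Qed.

(** * Single-kernel operations *)

Lemma has_kernel_op (R : realType) (tau : R) (G : Cplx R -> Cplx R)
    (op : single_kernel_op R) (D : kernel_data R) :
  is_barnes_double_gamma tau G ->
  has_kernel tau G (op_kernel op (barnes_kernel tau G D)) (op_data tau op D).
Proof.
move=> barnesG; have refl := has_kernel_refl tau G D.
have two r1 c1 r2 c2 : has_kernel tau G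
    (fun s => multiplier r2 c2 s *
              (multiplier r1 c1 s * barnes_kernel tau G D s))
    (insertion tau r2 c2 (insertion tau r1 c1 D)).
  by do 2![apply: has_kernel_insertion => //].
case: op => [g d|b g|k|].
- apply: has_kernel_scale (two GammaMinus (g + 1) InvGammaMinus (g + d + 1)).
  by move=> s /=; rewrite -[LHS]mul1r; congr (1 * _); ring.
- apply: has_kernel_scale (two GammaMinus b InvGammaMinus (b + g)).
  by move=> s /=; rewrite -!mulrA; congr (cgamma g * _); ring.
- apply: has_kernel_scale (two GammaPlus k%:R InvGammaPlus 0).
  move=> s /=; rewrite add0r (addrC s) -!mulrA.
  by congr ((-1) ^+ k * _); ring.
- have := has_kernel_insertion GammaPlus 0 barnesG (has_kernel_reflect tau G D).
  by apply: has_kernel_scale => s /=; rewrite add0r -[LHS]mul1r.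
Qed.

Lemma invN_op (R : realType) (tau : R) (op : single_kernel_op R)
    (D : kernel_data R) : invN (op_data tau op D) = invN D.
Proof.
by case: op => *; rewrite /op_data !invN_insertion ?invN_reflect.
Qed.

(** * Mellin convolution *)

Lemma barnes_kernel_convolution (R : realType) (tau : R)
    (G : Cplx R -> Cplx R) (D1 D2 : kernel_data R) (s : Cplx R) :
  barnes_kernel tau G (mellin_convolution D1 D2) s =
  barnes_kernel tau G D1 s * barnes_kernel tau G D2 s.
Proof.
rewrite /barnes_kernel /kernel_denominator /= !big_cat /= mulrDr 2!mulrDl.
by rewrite cexpD !invfM; ring.
Qed.

Lemma invN_convolution (R : realType) (D1 D2 : kernel_data R) :
  invN (mellin_convolution D1 D2) = invN D1 + invN D2.
Proof.
by rewrite /invN /ord_m /ord_n /ord_p /ord_q /= !size_cat !PoszD; ring.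
Qed.

Theorem theorem10p8 (R : realType) (tau : R) (G : Cplx R -> Cplx R)
    (tau_gt0 : 0 < tau) (barnesG : is_barnes_double_gamma tau G) :
  [/\ forall (r : insertion_rule) (c : Cplx R) (D : kernel_data R),
        let D' := insertion tau r c D in
        [/\ has_kernel tau G (fun s => multiplier r c s * barnes_kernel tau G D s) D',
            invN D' = invN D,
            (ord_p D')%:Z - (ord_q D')%:Z = (ord_p D)%:Z - (ord_q D)%:Z,
            inv_mu D' = inv_mu D + delta_mu tau r
          & inv_nu D' = inv_nu D + delta_nu tau r],
      forall (op : single_kernel_op R) (D : kernel_data R),
        has_kernel tau G (op_kernel op (barnes_kernel tau G D)) (op_data tau op D) /\
        invN (op_data tau op D) = invN D
    & forall D1 D2 : kernel_data R,
        let D := mellin_convolution D1 D2 in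
        (forall s, barnes_kernel tau G D s = barnes_kernel tau G D1 s * barnes_kernel tau G D2 s) /\
        [/\ invN D = invN D1 + invN D2,
            alpha D = alpha D1 + alpha D2,
            inv_mu D = inv_mu D1 + inv_mu D2,
            inv_nu D = inv_nu D1 + inv_nu D2
          & inv_xi D = inv_xi D1 + inv_xi D2] ].
Proof.
split=> [r c D D'|op D|D1 D2 D].
- split; [|exact: invN_insertion|exact: ord_pq_insertion
           |exact: inv_mu_insertion|exact: inv_nu_insertion].
  by apply: has_kernel_insertion => //; exact: has_kernel_refl.
- by split; [exact: has_kernel_op|exact: invN_op].
- split; first exact: barnes_kernel_convolution.
  split; [exact: invN_convolution|by []| | |].
  + by rewrite /inv_mu /= !big_cat /=; ring.
  + by rewrite /inv_nu /= !big_cat /=; ring.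
  + by rewrite /inv_xi /= !big_cat /=; ring.
Qed.
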